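(* Let $L$ be a finite-dimensional simple Lie algebra over a field $F$ of characteristic $0$ and let $r=\sum_i a_i\otimes b_i\in L\otimes L$, $r\neq0$, be a solution of the classical Yang–Baxter equation such that $r+\tau(r)\neq0$ and $r+\tau(r)$ is $L$-invariant. Then there exists a non-degenerate symmetric invariant bilinear form $\omega$ on $L$ such that the operator $R:L\to L$ defined by $$R(a)=\sum_i\omega(b_i,a)\,a_i$$ is a Rota–Baxter operator of some nonzero weight $\lambda\in F$ and, for all $a\in L$, $$R(a)+R^*(a)+\lambda a=0,$$ where $R^*$ is the adjoint of $R$ with respect to $\omega$.
   Context: A bilinear form $\omega$ on $L$ is invariant if $\omega([a,b],c)=\omega(a,[b,c])$ for all $a,b,c\in L$. The adjoint $R^*$ of $R$ is defined by $\omega(R(x),y)=\omega(x,R^*(y))$ for all $x,y\in L$. An element $r=\sum_i a_i\otimes b_i\in L\otimes L$ is a solution of the classical Yang–Baxter equation (CYBE) if $$\sum_{i,j}\big([a_i,a_j]\otimes b_i\otimes b_j-a_i\otimes[a_j,b_i]\otimes b_j+a_i\otimes a_j\otimes[b_i,b_j]\big)=0 .$$ $\tau$ is the switch map, $\tau(\sum_i a_i\otimes b_i)=\sum_i b_i\otimes a_i$. An element $s=\sum_i c_i\otimes d_i\in L\otimes L$ is $L$-invariant if $[s,y]:=\sum_i([c_i,y]\otimes d_i+c_i\otimes[d_i,y])=0$ for all $y\in L$. A linear map $R:L\to L$ is a Rota–Baxter operator of weight $\lambda\in F$ if $[R(x),R(y)]=R([R(x),y]+[x,R(y)]+\lambda[x,y])$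 for all $x,y\in L$. *)

(* Defs.v *)
From HB Require Import structures.
From mathcomp Require Import all_boot all_order all_algebra.

Set Implicit Arguments.
Unset Strict Implicit.
Unset Printing Implicit Defensive.

Import GRing.Theory VectorInternalTheory.
Local Open Scope ring_scope.

HB.mixin Record Vector_isLieAlgebra (F : fieldType) L of Vector F L := {
  lie : L -> L -> L;
  lie_bilinear : bilinear_for *:%R *:%R lie;
  lie_alternating : forall x : L, lie x x = 0;
  lie_jacobi : forall x y z : L,
    lie x (lie y z) + lie y (lie z x) + lie z (lie x y) = 0
}.

(* Finite-dimensional Lie algebras: finite dimension is part of [Vector]. *)
#[short(type="finLieAlgType")]
HB.structure Definition FinLieAlgebra (F : fieldType) :=
  { L of Vector F L & Vector_isLieAlgebra F L }.

Notation "[| x , y |]" := (lie x y)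
  (at level 0, x, y at level 99, format "[| x ,  y |]") : ring_scope.

HB.instance Definition _ (F : fieldType) (L : finLieAlgType F) :=
  bilinear_isBilinear.Build F L L L *:%R *:%R (@lie F L) (@lie_bilinear F L).

Section SimpleLie.
Variables (F : fieldType) (L : finLieAlgType F).

Definition lie_ideal (I : {vspace L}) : Prop :=
  forall x y : L, y \in I -> [|x, y|] \in I.

Definition simple_lie : Prop :=
  (exists x y : L, [|x, y|] != 0) /\
  (forall I : {vspace L}, lie_ideal I -> I = 0%VS \/ I = fullv).

End SimpleLie.

(* The tensor product of finite-dimensional vector spaces, realised as matrices
   of coordinates in the chosen bases of U and V; [tensor_lift_pure],
   [tensor_lift_linear] and [tensor_ext] are its universal property. *)
Section Tensor.
Variable F : fieldType.
Implicit Types U V W : vectType F.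

Definition tensor U V : Type := 'M[F]_(dim U, dim V).

HB.instance Definition _ U V := Vector.copy (tensor U V) 'M[F]_(dim U, dim V).

Definition pure U V (u : U) (v : V) : tensor U V := (v2r u)^T *m v2r v.

Lemma pure_bilinear U V : bilinear_for *:%R *:%R (@pure U V).
Proof.
split=> [v|u] k x y; rewrite /pure.
- by rewrite !linearP mulmxDl -scalemxAl.
- by rewrite linearP mulmxDr -scalemxAr.
Qed.

HB.instance Definition _ U V :=
  bilinear_isBilinear.Build F U V (tensor U V) *:%R *:%R (@pure U V)
    (@pure_bilinear U V).

Definition tensor_lift U V (W : lmodType F) (f : U -> V -> W) (t : tensor U V)
    : W :=
  \sum_(i < dim U) \sum_(j < dim V)
    (t : 'M_(_, _)) i j *: f (r2v (delta_mx 0 i)) (r2v (delta_mx 0 j)).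

Lemma tensor_lift_linear U V (W : lmodType F) (f : U -> V -> W) :
  linear (tensor_lift f).
Proof.
move=> k s t; rewrite /tensor_lift scaler_sumr -big_split.
apply: eq_bigr => i _; rewrite scaler_sumr -big_split; apply: eq_bigr => j _.
by rewrite !mxE scalerDl scalerA.
Qed.

HB.instance Definition _ U V (W : lmodType F) (f : U -> V -> W) :=
  GRing.isLinear.Build F (tensor U V) W _ (tensor_lift f)
    (tensor_lift_linear f).

Lemma vect_sum_coord U (u : U) :
  u = \sum_i v2r u 0 i *: r2v (delta_mx 0 i).
Proof.
rewrite -{1}(v2rK u) [v2r u in LHS]row_sum_delta linear_sum.
by apply: eq_bigr => i _; rewrite linearZ.
Qed.

Lemma tensor_lift_pure U V (W : lmodType F) (f : U -> V -> W) (u : U) (v : V) :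
  bilinear_for *:%R *:%R f -> tensor_lift f (pure u v) = f u v.
Proof.
move=> f_bil.
pose mf := bilinear_isBilinear.Build F U V W *:%R *:%R f f_bil.
pose g : {bilinear U -> V -> W} := HB.pack f mf.
rewrite -[f]/(g : U -> V -> W) [in RHS](vect_sum_coord u) linear_sumlz.
apply: eq_bigr => i _; rewrite linearZl_LR [in RHS](vect_sum_coord v).
rewrite linear_sumr scaler_sumr; apply: eq_bigr => j _.
by rewrite linearZr_LR scalerA !mxE big_ord1 !mxE.
Qed.

Lemma tensor_lift_sum U V (W : lmodType F) (f : U -> V -> W)
    n (u : 'I_n -> U) (v : 'I_n -> V) :
  bilinear_for *:%R *:%R f ->
  tensor_lift f (\sum_i pure (u i) (v i)) = \sum_i f (u i) (v i).
Proof.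
move=> f_bil; rewrite linear_sum /=; apply: eq_bigr => i _.
exact: tensor_lift_pure.
Qed.

Lemma tensor_ext U V (W : lmodType F) (g h : {linear tensor U V -> W}) :
  (forall u v, g (pure u v) = h (pure u v)) -> g =1 h.
Proof.
move=> gh t; rewrite [t]matrix_sum_delta !linear_sum; apply: eq_bigr => i _.
rewrite !linear_sum; apply: eq_bigr => j _; rewrite !linearZ; congr (_ *: _).
have -> : delta_mx i j = pure (r2v (delta_mx 0 i)) (r2v (delta_mx 0 j)) :> tensor U V.
  by rewrite /pure !r2vK trmx_delta mul_delta_mx.
exact: gh.
Qed.

Definition switch U V : tensor U V -> tensor V U :=
  tensor_lift (fun u v => pure v u).

End Tensor.

Notation "u \ox v" := (pure u v) (at level 40, left associativity) : ring_scope.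

Section YangBaxter.
Variables (F : fieldType) (L : finLieAlgType F).
Implicit Types (r s : tensor L L) (x y : L).

Definition tensor_bracket s y : tensor L L :=
  tensor_lift (fun c d => [|c, y|] \ox d + c \ox [|d, y|]) s.

Definition lie_invariant s : Prop := forall y, tensor_bracket s y = 0.

(* L \ox L \ox L is [tensor L (tensor L L)]. *)
Definition cybe_lhs r : tensor L (tensor L L) :=
  tensor_lift (fun a b =>
    tensor_lift (fun a' b' =>
      [|a, a'|] \ox (b \ox b') - a \ox ([|a', b|] \ox b')
      + a \ox (a' \ox [|b, b'|])) r) r.

Definition cybe_solution r : Prop := cybe_lhs r = 0.

Lemma switch_sum n (a b : 'I_n -> L) :
  switch (\sum_i a i \ox b i) = \sum_i b i \ox a i.
Proof.
rewrite /switch tensor_lift_sum //; split=> [v|u] k x y.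
- by rewrite linearPr.
- by rewrite linearPl.
Qed.

Lemma tensor_bracket_sum n (c d : 'I_n -> L) y :
  tensor_bracket (\sum_i c i \ox d i) y
  = \sum_i ([|c i, y|] \ox d i + c i \ox [|d i, y|]).
Proof.
rewrite /tensor_bracket tensor_lift_sum //; split=> [v|u] k x z.
- by rewrite !linearPl /= scalerDr addrACA.
- by rewrite linearPl !linearPr /= scalerDr addrACA.
Qed.

Lemma cybe_lhs_sum n (a b : 'I_n -> L) :
  cybe_lhs (\sum_i a i \ox b i)
  = \sum_i \sum_j
      ([|a i, a j|] \ox (b i \ox b j) - a i \ox ([|a j, b i|] \ox b j)
       + a i \ox (a j \ox [|b i, b j|])).
Proof.
pose T (a b a' b' : L) : tensor L (tensor L L) :=
  [|a, a'|] \ox (b \ox b') - a \ox ([|a', b|] \ox b')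
  + a \ox (a' \ox [|b, b'|]).
have addT k (p p' q q' s s' : tensor L (tensor L L)) :
    k *: p + p' - (k *: q + q') + (k *: s + s')
    = k *: (p - q + s) + (p' - q' + s').
  by rewrite scalerDr scalerBr opprD [k *: p + p' + _]addrACA [LHS]addrACA.
have lin1 b0 a1 b1 : linear (fun a0 => T a0 b0 a1 b1).
  by move=> k u v; rewrite /T !linearPl /= addT.
have lin2 a0 a1 b1 : linear (fun b0 => T a0 b0 a1 b1).
  by move=> k u v; rewrite /T !(linearPl, linearPr) /= addT.
have lin3 a0 b0 b1 : linear (fun a1 => T a0 b0 a1 b1).
  by move=> k u v; rewrite /T !(linearPl, linearPr) /= addT.
have lin4 a0 b0 a1 : linear (fun b1 => T a0 b0 a1 b1).
  by move=> k u v; rewrite /T !(linearPl, linearPr) /= addT.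
have inner a0 b0 :
    tensor_lift (T a0 b0) (\sum_i a i \ox b i) = \sum_j T a0 b0 (a j) (b j).
  by rewrite tensor_lift_sum //.
have bil : bilinear_for *:%R *:%R
    (fun a0 b0 => tensor_lift (T a0 b0) (\sum_i a i \ox b i)).
  split=> [v|u] k x y; rewrite !inner /= scaler_sumr -big_split;
  by apply: eq_bigr => j _ /=; first [exact: lin1 | exact: lin2].
rewrite [LHS](tensor_lift_sum _ _ bil).
by apply: eq_bigr => i _; rewrite inner.
Qed.

End YangBaxter.

Section RotaBaxter.
Variables (F : fieldType) (L : finLieAlgType F).
Implicit Types (omega : {symmetric L}) (R : L -> L).

Definition invariant_form omega : Prop :=
  forall a b c : L, omega [|a, b|] c = omega a [|b, c|].

Definition adjoint_wrt omega R Rstar : Prop :=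
  forall x y : L, omega (R x) y = omega x (Rstar y).

Lemma adjoint_wrt_unique omega R R1 R2 :
  nondegenerate omega -> adjoint_wrt omega R R1 -> adjoint_wrt omega R R2 ->
  R1 =1 R2.
Proof.
move=> /eqP nd ad1 ad2 y; apply/eqP; rewrite -subr_eq0 -memv0 -nd.
apply/mem_orthovP => x _; rewrite hermC expr0 mul1r /= linearBr.
apply/eqP; rewrite subr_eq0; apply/eqP.
exact: etrans (esym (ad1 x y)) (ad2 x y).
Qed.

Definition rota_baxter (lambda : F) R : Prop :=
  linear R /\
  (forall x y : L,
     [|R x, R y|] = R ([|R x, y|] + [|x, R y|] + lambda *: [|x, y|])).

End RotaBaxter.

(* Main.v *)
(** The invariant tensor [s = r + switch r] defines a map from the dual of [L]
    to [L] whose image is an ideal; as [s] is nonzero and [L] is simple, this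
    map is invertible, and its inverse is a non-degenerate symmetric invariant
    form [omega]. By construction the contractions of the two legs of [r] with
    [omega] satisfy [R + R^* = id], and contracting the last two legs of the
    Yang-Baxter equation with [omega] gives the Rota-Baxter identity of weight
    [-1]. *)
Require Import Defs.
From HB Require Import structures.
From mathcomp Require Import all_boot all_order all_algebra.

Set Implicit Arguments.
Unset Strict Implicit.
Unset Printing Implicit Defensive.

Import GRing.Theory.
Import VectorInternalTheory.
Local Open Scope ring_scope.

(** * Bilinear forms given by Gram matrices *)

Section MatrixForm.
Variables (F : fieldType) (L : vectType F).

Definition form_mx (M : 'M[F]_(dim L)) (x y : L) : F :=
  (v2r x *m M *m (v2r y)^T) 0 0.

Lemma form_mx_bilinear M : bilinear_for *%R *%R (form_mx M).
Proof.
split=> [y|x] k u v; rewrite /form_mx.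
- by rewrite linearP !mulmxDl -!scalemxAl !mxE.
- by rewrite !linearP /= !mxE.
Qed.

Lemma form_mx_sym M : M^T = M -> forall x y, form_mx M x y = form_mx M y x.
Proof.
move=> MT x y; rewrite /form_mx.
transitivity ((v2r x *m M *m (v2r y)^T)^T 0 0); first by rewrite [RHS]mxE.
by rewrite !trmx_mul trmxK MT mulmxA.
Qed.

Lemma symmetric_of_mx (M : 'M[F]_(dim L)) :
  M^T = M -> exists omega : {symmetric L}, omega =2 form_mx M.
Proof.
move=> MT.
have [linl linr] := form_mx_bilinear M.
(* [{symmetric L}] is the Hermitian structure with sign bit [false] and trivial twist [idfun], so
   right linearity and symmetry are restated in that shape. *)
have linr' x : GRing.linear_for (idfun \; *%R) (form_mx M x) by exact: linr.
have herm x y : form_mx M x y = (-1) ^+ false * idfun (form_mx M y x).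
  by rewrite expr0 mul1r form_mx_sym.
pose m1 := bilinear_isBilinear.Build F L L F *%R (idfun \; *%R) (form_mx M)
  (conj linl linr').
pose m2 := isHermitianSesquilinear.Build F L false idfun (form_mx M) herm.
pose omega : {symmetric L} := HB.pack (form_mx M) m1 m2.
by exists omega.
Qed.

Lemma form_mx_nondegenerate (M : 'M[F]_(dim L)) (omega : {symmetric L}) :
  M \in unitmx -> omega =2 form_mx M -> nondegenerate omega.
Proof.
move=> Mu omegaE; rewrite /nondegenerate -subv0; apply/subvP => x.
move=> /mem_orthovP xrad; rewrite memv0.
(* Pairing a radical vector with the basis reads off the entries of this row one by one. *)
have xM0 : v2r x *m M = 0.
  apply/rowP => j; rewrite [RHS]mxE.
  have := xrad (r2v (delta_mx 0 j)) (memvf _).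
  by rewrite omegaE /form_mx r2vK trmx_delta -colE mxE.
apply/eqP; apply: (can_inj (@v2rK _ _)).
by rewrite linear0 -[LHS](mulmxK Mu) xM0 mul0mx.
Qed.

End MatrixForm.

(** * Invariant tensors as matrices *)

Section InvariantTensor.
Variables (F : fieldType) (L : finLieAlgType F).
Implicit Types (s : tensor L L) (x y : L).

Lemma lieC x y : [|x, y|] = - [|y, x|].
Proof.
have := lie_alternating (x + y).
rewrite linearDl !linearDr /= !lie_alternating add0r addr0.
by move=> /eqP; rewrite addr_eq0 => /eqP.
Qed.

(** Matrix of the right bracket with [y], acting on coordinate rows; it is minus the usual adjoint
    map, a choice that matches [tensor_bracket]. *)
Definition ad_mx y : 'M[F]_(dim L) :=
  lin1_mx (fun u => v2r [|r2v u : L, y|]).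

Lemma mul_ad_mx x y : v2r x *m ad_mx y = v2r [|x, y|].
Proof.
have lin : linear (fun u => v2r [|r2v u : L, y|]).
  by move=> k u v; rewrite linearP linearPl linearP.
pose m := GRing.isLinear.Build F _ _ _ _ lin.
pose f : {linear 'rV[F]_(dim L) -> 'rV[F]_(dim L)} :=
  HB.pack (fun u => v2r [|r2v u : L, y|]) m.
by rewrite /ad_mx (mul_rV_lin1 f) /= v2rK.
Qed.

Lemma switch_tr s : switch s = s^T.
Proof.
have lin : linear (fun t : tensor L L => t^T : tensor L L).
  by move=> k u v; rewrite linearP.
pose g : {linear tensor L L -> tensor L L} :=
  HB.pack (fun t : tensor L L => t^T : tensor L L)
    (GRing.isLinear.Build F _ _ _ _ lin).
pose h : {linear tensor L L -> tensor L L} :=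
  tensor_lift (fun u v : L => pure v u).
apply: (@tensor_ext F L L _ h g) => u v /=.
rewrite tensor_lift_pure; first by rewrite /pure trmx_mul trmxK.
by split=> [w|w] k x y; rewrite ?linearPr ?linearPl.
Qed.

(** A pure tensor is a column times a row, so bracketing the first leg multiplies on the left by a
    transpose and bracketing the second multiplies on the right. Invariance thus reads
    [A^T s = - s A] with [A = ad_mx y]. *)
Lemma tensor_bracket_mx s y :
  tensor_bracket s y = (ad_mx y)^T *m s + s *m ad_mx y.
Proof.
have lin : linear
    (fun t : tensor L L => (ad_mx y)^T *m t + t *m ad_mx y : tensor L L).
  move=> k u v; rewrite !mulmxDr !mulmxDl -!scalemxAr -!scalemxAl scalerDr.
  exact: addrACA.
pose g : {linear tensor L L -> tensor L L} :=
  HB.pack (fun t : tensor L L => (ad_mx y)^T *m t + t *m ad_mx y : tensor L L)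
    (GRing.isLinear.Build F _ _ _ _ lin).
pose h : {linear tensor L L -> tensor L L} :=
  tensor_lift (fun c d => [|c, y|] \ox d + c \ox [|d, y|]).
apply: (@tensor_ext F L L _ h g) => u v /=.
rewrite tensor_lift_pure.
  by rewrite /pure -!mul_ad_mx trmx_mul !mulmxA.
split=> [w|w] k x z.
- by rewrite !linearPl /= scalerDr addrACA.
- by rewrite linearPl !linearPr /= scalerDr addrACA.
Qed.

Lemma invariant_unitmx s :
  simple_lie L -> s != 0 -> lie_invariant s -> (s : 'M_(dim L)) \in unitmx.
Proof.
move=> [_ simpleL] s_neq0 s_inv.
pose f : 'Hom('rV[F]_(dim L), L) := linfun (r2v \o mulmxr (s : 'M_(dim L))).
have fE u : f u = r2v (u *m s) by rewrite lfunE.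
have ideal_f : lie_ideal (limg f).
  move=> x _ /memv_imgP[u _ ->]; apply/memv_imgP.
  (* By invariance, [[x, u s] = - u s A = u A^T s] with [A = ad_mx x]. *)
  exists (u *m (ad_mx x)^T); first exact: memvf.
  apply: (can_inj (@v2rK _ _)); rewrite lieC linearN /= -mul_ad_mx !fE !r2vK.
  have /eqP := s_inv x; rewrite tensor_bracket_mx addr_eq0 => /eqP E.
  by rewrite -!mulmxA E mulmxN.
have [f0 | ffull] := simpleL _ ideal_f.
- case/eqP: s_neq0; apply/row_matrixP => i; rewrite row0 rowE.
  have : f (delta_mx 0 i) \in limg f by rewrite memv_img ?memvf.
  rewrite f0 memv0 fE => /eqP /(canRL (@r2vK _ _)) ->; exact: linear0.
(* Surjectivity puts every row of the identity in the row space of [s]. *)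
- rewrite -row_full_unit -sub1mx; apply/row_subP => i.
  have : r2v (row i 1%:M) \in limg f by rewrite ffull memvf.
  case/memv_imgP => u _; rewrite fE => /(can_inj (@r2vK _ _)) ->.
  exact: submxMl.
Qed.

(** Multiplying [s A = - A^T s] by the inverse of [s] on both sides makes the right bracket with [b]
    skew for the inverse form; the sign is absorbed by [[b, c] = - [c, b]]. *)
Lemma form_mx_invariant s :
  (s : 'M_(dim L)) \in unitmx -> lie_invariant s ->
  forall a b c : L,
    form_mx (invmx s) [|a, b|] c = form_mx (invmx s) a [|b, c|].
Proof.
move=> su s_inv a b c.
have skew : ad_mx b *m invmx s = - (invmx s *m (ad_mx b)^T).
  have /eqP := s_inv b; rewrite tensor_bracket_mx addrC addr_eq0 => /eqP sA.
  apply: (can_inj (mulKmx su)); apply: (can_inj (mulmxK su)).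
  by rewrite mulmxA mulmxKV // sA mulmxN mulmxA mulmxV // mul1mx mulNmx.
rewrite /form_mx [in RHS]lieC linearN /= -!mul_ad_mx linearN /= trmx_mul.
by rewrite mulmxN -(mulmxA (v2r a)) skew mulmxN mulNmx !mulmxA.
Qed.

End InvariantTensor.

(** * Contracting the legs of a tensor with a form *)

Section Contraction.
Variables (F : fieldType) (L : finLieAlgType F).
Variables (omega : {symmetric L}) (n : nat) (a b : 'I_n -> L).

Let R (x : L) : L := \sum_i omega (b i) x *: a i.
Let Rstar (x : L) : L := \sum_i omega (a i) x *: b i.

Lemma form_symC (x y : L) : omega x y = omega y x.
Proof. by rewrite hermC expr0 mul1r. Qed.

Lemma contraction_linear : linear R.
Proof.
move=> k x y; rewrite /R scaler_sumr -big_split; apply: eq_bigr => i _ /=.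
by rewrite linearPr /= scalerDl scalerA.
Qed.

Lemma contraction_adjoint : adjoint_wrt omega R Rstar.
Proof.
move=> x y; rewrite /R /Rstar linear_sumlz linear_sumr; apply: eq_bigr => i _.
by rewrite /= linearZl_LR linearZr_LR /= [omega x _]form_symC mulrC.
Qed.

(** Keep the first leg of the Yang-Baxter equation and pair the second with [x] and the third with
    [y]; its three terms become the three terms here. *)
Lemma cybe_contract (x y : L) :
  invariant_form omega -> cybe_solution (\sum_i a i \ox b i) ->
  [|R x, R y|] = R [|x, R y|] - R [|Rstar x, y|].
Proof.
move=> inv; rewrite /cybe_solution cybe_lhs_sum => cybe.
(* [F^o] is [F] seen as a module over itself, as [tensor_lift] requires. *)
pose g (u v : L) : F^o := omega u x * omega v y.
have g_bil : bilinear_for *:%R *:%R g.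
  split=> [v|u] k p q; rewrite /g linearPl /= /GRing.scale /=.
  - by rewrite mulrDl mulrA.
  - by rewrite mulrDr mulrCA.
pose h (u : L) (t : tensor L L) : L := (tensor_lift g t : F) *: u.
have h_bil : bilinear_for *:%R *:%R h.
  split=> [v|u] k p q; rewrite /h.
  - by rewrite /= scalerDr !scalerA mulrC.
  - by rewrite /= linearP scalerDl scalerA.
have hE u v w : tensor_lift h (u \ox (v \ox w)) = (omega v x * omega w y) *: u.
  by rewrite tensor_lift_pure // /h tensor_lift_pure.
have : tensor_lift h 0 = 0 by rewrite linear0.
rewrite -{1}cybe linear_sum /=.
under eq_bigr => i _.
  rewrite linear_sum /=.
  under eq_bigr => j _ do rewrite linearD linearB /= !hE.
  rewrite big_split sumrB /=.
over.
rewrite big_split sumrB /=.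
have -> : \sum_i \sum_j (omega (b i) x * omega (b j) y) *: [|a i, a j|]
    = [|R x, R y|].
  rewrite /R linear_sumlz; apply: eq_bigr => i _; rewrite linear_sumr.
  by apply: eq_bigr => j _; rewrite /= linearZl_LR linearZr_LR /= scalerA.
have -> : \sum_i \sum_j (omega [|a j, b i|] x * omega (b j) y) *: a i
    = R [|x, R y|].
  apply: eq_bigr => i _; rewrite -scaler_suml; congr (_ *: _).
  rewrite /R linear_sumr linear_sumr; apply: eq_bigr => j _.
  rewrite /= !linearZr_LR /= mulrC; congr (_ * _).
  (* Invariance and symmetry together let the three arguments of [omega [|u, v|] w] rotate
     cyclically. *)
  by rewrite inv form_symC inv form_symC inv.
have -> : \sum_i \sum_j (omega (a j) x * omega [|b i, b j|] y) *: a i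
    = R [|Rstar x, y|].
  apply: eq_bigr => i _; rewrite -scaler_suml; congr (_ *: _).
  rewrite -inv /Rstar linear_sumr linear_sumlz; apply: eq_bigr => j _.
  by rewrite /= linearZr_LR linearZl_LR.
by move=> /eqP; rewrite addr_eq0 subr_eq addrC; move=> /eqP.
Qed.

(** Substituting [Rstar x = - (R x + lambda *: x)] into [cybe_contract] yields the two missing terms
    of the identity. *)
Lemma contraction_rota_baxter (lambda : F) :
  invariant_form omega -> cybe_solution (\sum_i a i \ox b i) ->
  (forall x, R x + Rstar x + lambda *: x = 0) -> rota_baxter lambda R.
Proof.
move=> inv cybe RRstar; split=> [ |x y]; first exact: contraction_linear.
rewrite cybe_contract //.
have -> : Rstar x = - (R x + lambda *: x).
  by apply/eqP; rewrite eq_sym eqr_oppLR -addr_eq0 addrAC RRstar.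
pose Rl : {linear L -> L} :=
  HB.pack R (GRing.isLinear.Build F L L *:%R R contraction_linear).
rewrite linearNl /= linearDl /= linearZl_LR /= -[R]/(Rl : L -> L).
by rewrite -linearB opprK addrA [[|x, _|] + _]addrC.
Qed.

End Contraction.

Lemma contraction_sum (F : fieldType) (L : finLieAlgType F)
    n (a b : 'I_n -> L) (omega : {symmetric L}) (r : tensor L L) :
  r = \sum_(i < n) a i \ox b i ->
  (r + switch r : 'M_(dim L)) \in unitmx ->
  omega =2 form_mx (invmx (r + switch r : 'M_(dim L))) ->
  forall x : L,
    \sum_i omega (b i) x *: a i + \sum_i omega (a i) x *: b i = x.
Proof.
move=> rE su omegaE x; set S := (X in invmx X) in omegaE.
have ST : S^T = S by rewrite /S switch_tr linearD /= trmxK addrC.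
have MT : (invmx S)^T = invmx S by rewrite trmx_inv ST.
(* Each contraction is multiplication of the row [v2r x *m invmx S] by a rank-one matrix; the two
   sums add up to multiplication by [S], which cancels its inverse. *)
have scaleE (u v : L) :
    v2r (omega u x *: v) = v2r x *m invmx S *m (u \ox v : 'M_(dim L)).
  rewrite omegaE form_mx_sym // linearZ /= /pure mulmxA -mul_scalar_mx.
  by rewrite -mx11_scalar.
apply: (can_inj (@v2rK _ _)); rewrite linearD !linear_sum /=.
under eq_bigr => i _ do rewrite scaleE.
under [X in _ + X]eq_bigr => i _ do rewrite scaleE.
by rewrite -!mulmx_sumr -mulmxDr -switch_sum -rE addrC mulmxKV.
Qed.

Theorem corollary3 (F : fieldType) (L : finLieAlgType F)
    (n : nat) (a b : 'I_n -> L) (r : tensor L L) :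
  [pchar F] =i pred0 ->
  simple_lie L ->
  r = \sum_(i < n) a i \ox b i ->
  r != 0 ->
  cybe_solution r ->
  r + switch r != 0 ->
  lie_invariant (r + switch r) ->
  exists omega : {symmetric L},
    nondegenerate omega /\ invariant_form omega /\
    let R : L -> L := fun x => \sum_(i < n) omega (b i) x *: a i in
    exists lambda : F,
      lambda != 0 /\ rota_baxter lambda R /\
      exists Rstar : L -> L,
        adjoint_wrt omega R Rstar /\
        forall x : L, R x + Rstar x + lambda *: x = 0.
Proof.
move=> _ simpleL rE _ cybe s_neq0 s_inv.
have su := invariant_unitmx simpleL s_neq0 s_inv.
pose M := invmx (r + switch r : 'M_(dim L)).
have MT : M^T = M.
  by rewrite /M trmx_inv switch_tr linearD /= trmxK addrC.
have [omega omegaE] := symmetric_of_mx MT.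
have inv : invariant_form omega.
  by move=> x y z; rewrite !omegaE; exact: form_mx_invariant.
exists omega; split; first by apply: form_mx_nondegenerate omegaE; rewrite unitmx_inv.
(* The weight is forced by [contraction_sum], where the two contractions add up to the identity. *)
split=> // R; exists (-1); rewrite oppr_eq0 oner_eq0; split=> //.
have sum0 (x : L) : R x + \sum_i omega (a i) x *: b i + (-1) *: x = 0.
  by rewrite (contraction_sum rE su omegaE) scaleN1r subrr.
rewrite rE in cybe; split; first exact: contraction_rota_baxter.
exists (fun x => \sum_i omega (a i) x *: b i); split=> //.
exact: contraction_adjoint.
Qed.
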